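(* Let $(\kappa_n)_{n\ge 0}$ be a sequence of positive integers, let $D\subseteq\partial T$ be the Dobiński type set associated to $(\kappa_n)$, and let $a>0$ and $1<p<\infty$ be real numbers. In the case $ap=1$: (i) if $\limsup_{n\to\infty}\kappa_n^{-(p-1)}2^{n}>0$, then $\operatorname{cap}_{\frac1p,p}(D)>0$; (ii) if $\sum_{n=1}^\infty \kappa_n^{-(p-1)}2^{n}<\infty$, then $\operatorname{cap}_{\frac1p,p}(D)=0$. In the case $ap<1$: (a) if $\limsup_{n\to\infty}\big(apn-(1-ap)\kappa_n\big)>-\infty$, then $\operatorname{cap}_{a,p}(D)>0$; (b) if $\sum_{n=0}^\infty 2^{apn-(1-ap)\kappa_n}<+\infty$, then $\operatorname{cap}_{a,p}(D)=0$.
   Context: Dyadic tree. Let $T=\{0,1\}^*$ be the set of all finite words over $\{0,1\}$, including the empty word $e$; $|x|$ denotes the length of $x\in T$. Let $\partial T=\{0,1\}^{\mathbb{N}}$ be the set of infinite words $w=w_1w_2\cdots$, and $\overline{T}=T\cup\partial T$. For $y\in T$ and $x\in\overline{T}$ write $y\le x$ if $y$ is a prefix of $x$ (the empty word is a prefix of every word, and each finite word is a prefix of itself). Discrete capacity. For a function $\varphi:T\to[0,\infty)$ define its potential \[ I\varphi(x):=\sum_{y\in T,\ y\le x}\varphi(y),\quad x\in\overline{T}. \] For $a>0$, $1<p<\infty$ with $ap\le 1$ and $E\subseteq\partial T$, the discrete $(a,p)$-capacity of $E$ is \[ \operatorname{cap}_{a,p}(E):=\inf\Big\{\sum_{x\in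 T}\varphi(x)^p\,2^{-|x|(1-ap)} : \varphi\ge 0 \text{ and } I\varphi\ge 1 \text{ on } E\Big\}. \] Dobiński type set. For a sequence $(\kappa_n)$ of positive integers put \[ D(n,\kappa_n):=\{w\in\partial T: w_{n+1}=w_{n+2}=\dots=w_{n+\kappa_n}=0\}. \] The Dobiński type set associated to $(\kappa_n)$ is \[ D:=\limsup_{n\to\infty}D(n,\kappa_n)=\bigcap_{m=1}^\infty\bigcup_{n=m}^\infty D(n,\kappa_n). \] *)

(* Defs.v *)
From mathcomp Require Import all_boot all_order all_algebra.
From mathcomp Require Import all_classical all_reals all_analysis.

Set Implicit Arguments.
Unset Strict Implicit.
Unset Printing Implicit Defensive.

Import Order.TTheory GRing.Theory Num.Theory.

Local Open Scope classical_set_scope.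
Local Open Scope ring_scope.

Definition tree : Type := seq bool.

(* The letters of an infinite word are numbered from 0, so that the letter
   usually written w_(i+1) is [w i]; the letters 0 and 1 are [false] and
   [true]. *)
Definition boundary : Type := nat -> bool.

Inductive closed_tree : Type :=
  | Fin of tree
  | Inf of boundary.

Definition le_word (y : tree) (x : closed_tree) : bool :=
  match x with
  | Fin x => prefix y x
  | Inf w => y == mkseq w (size y)
  end.

Definition potential (R : realType) (phi : tree -> R) (x : closed_tree) :
    \bar R :=
  \esum_(y in [set y : seq bool | le_word y x]) (phi y)%:E.

Definition capacity (R : realType) (a p : R) (E : set boundary) : \bar R :=
  ereal_inf
    [set \esum_(x in [set: seq bool])
           ((phi x `^ p) * 2 `^ (- ((size x)%:R * (1 - a * p))))%:E
    | phi in [set phi : tree -> R |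
        (forall x, 0 <= phi x) /\
        (forall w, E w -> (1 <= potential phi (Inf w))%E)]].

(* The words w with w_(n+1) = ... = w_(n+k) = 0. *)
Definition zero_block (n k : nat) : set boundary :=
  [set w | forall i, (i < k)%N -> w (n + i)%N = false].

Definition dobinski (kappa : nat -> nat) : set boundary :=
  \bigcap_(m >= 1%N) \bigcup_(n >= m) zero_block n (kappa n).

(* Main.v *)
Require Import Defs.
From mathcomp Require Import all_boot all_order all_algebra.
From mathcomp Require Import all_classical all_reals all_analysis.
From mathcomp Require Import ring lra.

Import Order.TTheory GRing.Theory Num.Theory.
Import numFieldNormedType.Exports.

Local Open Scope classical_set_scope.
Local Open Scope ring_scope.

(** Put [s = 1 - a p].  For the upper bounds, the block [w_(n+1) ... w_(n+kappa_n)] is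
    charged uniformly along its vertices when [s = 0] and at its last vertex only when
    [s > 0]; the costs of these functions are the terms of the given series, so
    the tail of the series bounds the capacity of [D].

    For the lower bounds, let [phi] have cost less than [delta^p] with [delta] small;
    we build [w] in [D] along which the potential of [phi] stays below 1.  Given a
    vertex [v] whose normalised subtree energy
    [2^(|v|s) * sum_(x >= v) phi(x)^p 2^(-|x|s)] is at most [delta^p], an averaging
    over the words [u >= v] of length [n] finds [u] such that the path from [v] to
    [u 0^kappa_n] increases the potential by [O(delta)].  The limsup condition and the
    convergence of the total energy let [n] be chosen so that the normalised energy
    at [u 0^kappa_n] is as small as desired, so the step can be repeated with
    [delta / 2], [delta / 4], and so on.  Hoelder's inequality is replaced
    throughout by its linearised form [x <= t + t^(1-p) x^p]. *)

(** * Level sums and energies of subtrees *)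

Fixpoint level_sum {R : realType} (g : seq bool -> R) (k : nat)
    (v : seq bool) : R :=
  if k is k'.+1 then
    level_sum g k' (rcons v false) + level_sum g k' (rcons v true)
  else g v.

Definition partial_energy {R : realType} (f : seq bool -> R) (L : nat)
    (v : seq bool) : R :=
  \sum_(j < L) level_sum f j v.

(** The sum of [f] over the subtree at [v], taken as a real limit; it is used only where a finite
    total cost bounds the partial energies. *)
Definition energy {R : realType} (f : seq bool -> R) (v : seq bool) : R :=
  limn (partial_energy f ^~ v).

Definition path_sum {R : realType} (phi : seq bool -> R) (v : seq bool) : R :=
  \sum_(i < (size v).+1) phi (take i v).

Section LevelSum.
Context {R : realType}.
Implicit Types (f g phi : seq bool -> R) (v : seq bool).

Lemma level_sum_ge0 f k v : (forall x, 0 <= f x) -> 0 <= level_sum f k v.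
Proof. by move=> f0; elim: k v => [|k IH] v //=; rewrite addr_ge0. Qed.

Lemma level_sumD f g k v :
  level_sum (fun x => f x + g x) k v = level_sum f k v + level_sum g k v.
Proof. by elim: k v => [|k IH] v //=; rewrite !IH; ring. Qed.

Lemma level_sumZ c f k v :
  level_sum (fun x => c * f x) k v = c * level_sum f k v.
Proof. by elim: k v => [|k IH] v //=; rewrite !IH; ring. Qed.

(** A minimum is at most an average: the better of the two children is kept at each level. *)
Lemma exists_le_level_sum f k v : exists u : seq bool,
  [/\ prefix v u, size u = (size v + k)%N & 2 ^+ k * f u <= level_sum f k v].
Proof.
elim: k v => [|k IH] v.
  by exists v; rewrite prefix_refl addn0 expr0 mul1r.
have [u0 [p0 s0 l0]] := IH (rcons v false).
have [u1 [p1 s1 l1]] := IH (rcons v true).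
rewrite /=.
have pr b u : prefix (rcons v b) u -> prefix v u.
  by apply: prefix_trans; exact: prefix_rcons.
have [h|h] := leP (f u0) (f u1).
  exists u0; split; [exact: pr p0 | by rewrite s0 size_rcons addSnnS | ].
  rewrite exprS -mulrA.
  have : 2 ^+ k * f u0 <= 2 ^+ k * f u1 by rewrite ler_pM2l ?exprn_gt0.
  lra.
exists u1; split; [exact: pr p1 | by rewrite s1 size_rcons addSnnS | ].
rewrite exprS -mulrA.
have : 2 ^+ k * f u1 <= 2 ^+ k * f u0 by rewrite ler_pM2l ?exprn_gt0// ltW.
lra.
Qed.

Lemma partial_energyS f L v : partial_energy f L.+1 v =
  f v + (partial_energy f L (rcons v false) + partial_energy f L (rcons v true)).
Proof. by rewrite /partial_energy big_ord_recl /= -big_split. Qed.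

Lemma partial_energy_le_esum f L v : (forall x, 0 <= f x) ->
  ((partial_energy f L v)%:E <=
   \esum_(x in [set x : seq bool | prefix v x]) (f x)%:E)%E.
Proof.
move=> f0; elim: L v => [|L IH] v.
  by rewrite /partial_energy big_ord0; apply: esum_ge0 => x _; rewrite lee_fin.
rewrite partial_energyS !EFinD.
have f0E x : (0 <= (f x)%:E)%E by rewrite lee_fin.
apply: (@le_trans _ _ (\esum_(x in [set v]) (f x)%:E +
  (\esum_(x in [set x | prefix (rcons v false) x]) (f x)%:E +
   \esum_(x in [set x | prefix (rcons v true) x]) (f x)%:E))%E).
  by rewrite esum_set1//; apply: leeD => //; apply: leeD; exact: IH.
(* With indicators the comparison becomes pointwise: [x] is [v], lies below exactly one child of
   [v], or is not below [v]. *)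
rewrite [X in (X + _)%E]esum_mkcond [X in (_ + (X + _))%E]esum_mkcond.
rewrite [X in (_ + (_ + X))%E]esum_mkcond [leRHS]esum_mkcond.
have c0 (A : set (seq bool)) x : (0 <= if x \in A then (f x)%:E else 0)%E.
  by case: ifP.
rewrite -!esumD//; last by move=> x _; rewrite adde_ge0.
apply: le_esum => x _.
have [/prefixP[y ->]|nv] := boolP (prefix v x).
  rewrite [in leRHS]ifT; last by rewrite inE /= prefix_prefix.
  case: y => [|b y].
    rewrite cats0 ifT ?inE// !ifF ?adde0//; apply/negbTE/negP; rewrite inE /=;
      by move/size_prefix; rewrite size_rcons ltnn.
  rewrite ifF; last first.
    apply/negbTE/negP; rewrite inE /= => /(congr1 size) /eqP.
    by rewrite size_cat /= -[X in _ == X]addn0 eqn_add2l.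
  rewrite -cat_rcons add0e.
  have e b' : ((rcons v b ++ y) \in [set x | prefix (rcons v b') x]) = (b == b').
    apply/idP/idP; rewrite inE /=; last by move/eqP->; exact: prefix_prefix.
    move=> /prefixP[z /eqP]; rewrite eqseq_cat ?size_rcons//.
    by rewrite eqseq_rcons => /andP[/andP[_ ->]].
  by rewrite !e; clear e; case: b; rewrite /= ?adde0 ?add0e.
have nvr b : x \in [set x | prefix (rcons v b) x] = false.
  apply/negbTE/negP; rewrite inE /= => h; move/negP: nv; apply.
  exact: prefix_trans (prefix_rcons _ _) h.
rewrite !nvr !adde0 ifF//.
by apply/negbTE/negP; rewrite inE /= => xv; rewrite xv prefix_refl in nv.
Qed.

(** * Subtree energies under a finite total cost *)

Section Energy.
Variables (f : seq bool -> R) (B : R).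
Hypotheses (f_ge0 : forall x, 0 <= f x)
  (f_sum : (\esum_(x in [set: seq bool]) (f x)%:E <= B%:E)%E).

Lemma partial_energy_le L v : partial_energy f L v <= B.
Proof.
rewrite -lee_fin; apply: le_trans f_sum.
apply: (le_trans (partial_energy_le_esum f L v f_ge0)).
rewrite [leLHS]esum_mkcond; apply: le_esum => x _; case: ifP => // _.
by rewrite lee_fin.
Qed.

Lemma partial_energy_nd v : nondecreasing_seq (partial_energy f ^~ v).
Proof.
apply/nondecreasing_seqP => n.
by rewrite /partial_energy big_ord_recr /= lerDl level_sum_ge0.
Qed.

Lemma partial_energy_is_cvg v : cvgn (partial_energy f ^~ v).
Proof.
apply: nondecreasing_is_cvgn; first exact: partial_energy_nd.
by exists B => _ [L _ <-]; exact: partial_energy_le.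
Qed.

Lemma partial_energy_le_energy L v : partial_energy f L v <= energy f v.
Proof.
apply: nondecreasing_cvgn_le; first exact: partial_energy_nd.
exact: partial_energy_is_cvg.
Qed.

Lemma energy_ge0 v : 0 <= energy f v.
Proof.
by apply: le_trans (partial_energy_le_energy 0 v); rewrite /partial_energy big_ord0.
Qed.

Lemma energy_le v : energy f v <= B.
Proof.
apply: limr_le; first exact: partial_energy_is_cvg.
by apply: nearW => L; exact: partial_energy_le.
Qed.

Lemma energyE v :
  energy f v = f v + (energy f (rcons v false) + energy f (rcons v true)).
Proof.
apply: cvg_lim => //; rewrite -cvg_shiftS /=.
under eq_fun do rewrite partial_energyS.
apply: cvgD; first exact: cvg_cst.
by apply: cvgD; exact: partial_energy_is_cvg.
Qed.

(** Iterating [energyE] peels off the levels before [k]; what remains is a tail of a convergent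
    series. *)
Lemma level_sum_energy k v :
  level_sum (energy f) k v = energy f v - partial_energy f k v.
Proof.
elim: k v => [|k IH] v /=; first by rewrite /partial_energy big_ord0 subr0.
by rewrite !IH partial_energyS (energyE v); ring.
Qed.

Lemma level_sum_energy_cvg0 v : level_sum (energy f) k v @[k --> \oo] --> 0.
Proof.
under eq_fun do rewrite level_sum_energy.
rewrite -(subrr (energy f v)); apply: cvgB; first exact: cvg_cst.
exact: partial_energy_is_cvg.
Qed.

End Energy.

Lemma path_sum_nil phi : path_sum phi [::] = phi [::].
Proof. by rewrite /path_sum big_ord1. Qed.

Lemma path_sum_rcons phi v b :
  path_sum phi (rcons v b) = path_sum phi v + phi (rcons v b).
Proof.
rewrite /path_sum size_rcons big_ord_recr /=; congr (_ + phi _).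
  by apply: eq_bigr => i _; rewrite -cats1 takel_cat// -ltnS.
by rewrite take_oversize ?size_rcons.
Qed.

Lemma le_path_sum phi v x : (forall x, 0 <= phi x) -> prefix v x ->
  path_sum phi v <= path_sum phi x.
Proof.
move=> phi0 /prefixP[y ->]; elim/last_ind: y => [|y b IH]; first by rewrite cats0.
by rewrite -rcons_cat path_sum_rcons (le_trans IH)// lerDl.
Qed.

End LevelSum.

(** * Lower bounds *)

(** If [x > t], then [x = x^(1-p) x^p <= t^(1-p) x^p], since the exponent [1 - p] is negative. *)
Lemma le_add_powR (R : realType) (p t x : R) : 1 < p -> 0 < t -> 0 <= x ->
  x <= t + t `^ (1 - p) * x `^ p.
Proof.
move=> p1 t0 x0; have [xt|tx] := leP x t.
  by rewrite (le_trans xt)// lerDl mulr_ge0 ?powR_ge0.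
have xgt0 : 0 < x := lt_trans t0 tx.
apply: (@le_trans _ _ (t `^ (1 - p) * x `^ p)); last by rewrite lerDr ltW.
rewrite -(@mulr_powRB1 _ x p)//; last by rewrite (lt_trans _ p1).
rewrite mulrCA ler_peMr// -opprB powRN mulrC ler_pdivlMr ?powR_gt0// mul1r.
by rewrite ge0_ler_powR ?nnegrE ?subr_ge0 ?ltW.
Qed.

(** An infinite word has exactly one prefix of each length. *)
Lemma potentialE (R : realType) (phi : tree -> R) (w : boundary) :
  (forall x, 0 <= phi x) ->
  potential phi (Inf w) = (\sum_(0 <= i <oo) (phi (mkseq w i))%:E)%E.
Proof.
move=> phi0; rewrite nneseries_esumT; last by move=> n; rewrite lee_fin.
rewrite /potential; apply: reindex_esum; split.
- by move=> i _ /=; rewrite size_mkseq.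
- by move=> i j _ _ /(congr1 size); rewrite !size_mkseq.
- by move=> y /= /eqP ye; exists (size y).
Qed.

Lemma path_sum_mkseq (R : realType) (phi : tree -> R) (w : boundary) n :
  path_sum phi (mkseq w n) = \sum_(0 <= i < n.+1) phi (mkseq w i).
Proof.
rewrite /path_sum size_mkseq big_mkord; apply: eq_bigr => i _.
congr phi; rewrite /mkseq -map_take take_iota; congr (map _ (iota _ _)).
by apply/minn_idPl; rewrite -ltnS.
Qed.

(* [t i] is the threshold used at the vertex preceding the end of the zero block by
   [i] letters, and [M] bounds the energy factor picked up along the block; [M / 2^n]
   stays bounded for infinitely many [n]. *)
Definition affordable_blocks (R : realType) (kappa : nat -> nat) (s p C c : R) :=
  forall m, exists n, exists M : R, [/\ (m <= n)%N,
    2 `^ ((n + kappa n)%:R * s) <= M, M <= c * 2 ^+ n &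
    forall delta, 0 < delta -> exists t : nat -> R, [/\ forall i, 0 < t i,
      \sum_(i < kappa n) t i <= C * delta &
      forall i, (i < kappa n)%N ->
        t i `^ (1 - p) * 2 `^ ((n + (kappa n - i))%:R * s) <=
        delta `^ (1 - p) * M]].

(** * Words of small potential in the Dobiński set *)

Section LowerBound.
Context {R : realType}.
Variables (a p : R) (phi : tree -> R) (B : R).
Hypotheses (a_gt0 : 0 < a) (p_gt1 : 1 < p) (phi_ge0 : forall x, 0 <= phi x).

Let s := 1 - a * p.
Let f (x : seq bool) := phi x `^ p * 2 `^ (- ((size x)%:R * s)).
Let E := energy f.
Let J := path_sum phi.

Hypothesis cost_le : (\esum_(x in [set: seq bool]) (f x)%:E <= B%:E)%E.

Let f_ge0 x : 0 <= f x. Proof. by rewrite mulr_ge0 ?powR_ge0. Qed.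

Let E_ge0 v : 0 <= E v. Proof. exact: energy_ge0 f_ge0 cost_le v. Qed.

Let EE v : E v = f v + (E (rcons v false) + E (rcons v true)).
Proof. exact: energyE f_ge0 cost_le v. Qed.

Let le_fE v : f v <= E v.
Proof. by rewrite EE lerDl addr_ge0. Qed.

Let phi_powR x : phi x `^ p = 2 `^ ((size x)%:R * s) * f x.
Proof. by rewrite /f mulrCA -powRD ?pnatr_eq0 ?implybT// subrr powRr0 mulr1. Qed.

Let phi_le t x : 0 < t ->
  phi x <= t + t `^ (1 - p) * 2 `^ ((size x)%:R * s) * f x.
Proof. by move=> t0; rewrite -mulrA -phi_powR; exact: le_add_powR. Qed.

Let d : R := 2 `^ (- a).

Let d_gt0 : 0 < d. Proof. exact: powR_gt0. Qed.

Let d_lt1 : d < 1.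
Proof.
rewrite /d powRN invf_lt1 ?powR_gt0// /powR pnatr_eq0 expR_gt1.
by rewrite mulr_gt0// ln_gt0// ltr1n.
Qed.

(* Averages of [J] over the k-letter extensions of [v]: the weights [delta d^j] in
   [phi_le] are summable, and still compensate the growth of [2^((|v|+j)s)]
   against the [2^j] words at depth [j] because [s = 1 - a p]. *)
Lemma level_sum_path_sum k v delta : 0 < delta ->
  level_sum J k v <= 2 ^+ k * (J v + d / (1 - d) * delta +
    delta `^ (1 - p) * 2 `^ ((size v)%:R * s) * (E v - f v)).
Proof.
have C0 : 0 <= d / (1 - d) by rewrite divr_ge0 ?subr_ge0 ?ltW.
elim: k v delta => [|k IH] v delta delta0.
  rewrite /= expr0 mul1r -addrA lerDl addr_ge0//.
    exact: mulr_ge0 (ltW delta0).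
  by rewrite !mulr_ge0 ?powR_ge0 ?subr_ge0.
have deltad : 0 < delta * d by rewrite mulr_gt0.
pose W0 := delta `^ (1 - p) * 2 `^ ((size v)%:R * s).
pose W := (delta * d) `^ (1 - p) * 2 `^ ((size v).+1%:R * s).
(* One level down, the coefficient grows by [d^(1-p) 2^s = 2^(1-a)], less than the branching number
   2; this is the reason for [d = 2^(-a)]. *)
have WW0 : W <= 2 * W0.
  have -> : W = W0 * 2 `^ (1 - a).
    rewrite /W /W0 powRM ?ltW// -[(size v).+1%:R]natr1 mulrDl mul1r.
    rewrite [2 `^ (_ + _)]powRD ?pnatr_eq0 ?implybT// -[d `^ _]powRrM.
    rewrite (_ : 1 - a = - a * (1 - p) + s); last by rewrite /s; ring.
    by rewrite [2 `^ (_ + s)]powRD ?pnatr_eq0 ?implybT//; ring.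
  rewrite mulrC ler_wpM2r ?mulr_ge0 ?powR_ge0//.
  by rewrite -[leRHS](@powRr1 _ 2)// ler_powR ?ler1n// gerBl ltW.
have step b : level_sum J k (rcons v b) <=
    2 ^+ k * (J v + d / (1 - d) * delta + W * E (rcons v b)).
  apply: le_trans (IH (rcons v b) (delta * d) deltad) _.
  rewrite ler_pM2l ?exprn_gt0// [J (rcons _ _)]path_sum_rcons.
  have := phi_le _ (rcons v b) deltad.
  rewrite size_rcons -/W.
  (* Geometric series: its first term [delta * d] pays for the child, the rest is left to the
     induction. *)
  have -> : d / (1 - d) * delta = d / (1 - d) * (delta * d) + delta * d.
    by field; rewrite subr_eq0 gt_eqF.
  rewrite -/J; lra.
rewrite /=; apply: (le_trans (lerD (step false) (step true))).
rewrite -mulrDr exprS -[leRHS]mulrA mulrCA ler_pM2l ?exprn_gt0// -/W0.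
have -> : E v - f v = E (rcons v false) + E (rcons v true).
  by rewrite EE addrC addKr.
have := ler_wpM2r (addr_ge0 (E_ge0 (rcons v false)) (E_ge0 (rcons v true))) WW0.
lra.
Qed.

(** [phi_le] is applied at each vertex of the run, with threshold [t i] at the vertex [i] letters
    before the end. All coefficients are at most [M], and the values of [f] on the run add up to at
    most the energy strictly below [u]. *)
Lemma path_sum_run k u (t : nat -> R) M : 0 <= M ->
  (forall i, (i < k)%N -> 0 < t i) ->
  (forall i, (i < k)%N ->
    t i `^ (1 - p) * 2 `^ ((size u + (k - i))%:R * s) <= M) ->
  J (u ++ nseq k false) <= J u + \sum_(i < k) t i + M * (E u - f u).
Proof.
move=> M0; elim: k u => [|k IH] u t0 tM.
  by rewrite cats0 big_ord0 addr0 lerDl mulr_ge0// subr_ge0.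
rewrite -cat_rcons big_ord_recr /=.
have {}IH := IH (rcons u false).
apply: (le_trans (IH _ _)) => [i ik|i ik|].
- by apply: t0; rewrite ltnS ltnW.
- by rewrite size_rcons addSnnS -subSn ?(ltnW ik)// tM// ltnS ltnW.
have Eu : E (rcons u false) <= E u - f u by rewrite (EE u) addrC addKr lerDl.
have := phi_le _ (rcons u false) (t0 k (ltnSn k)).
have := tM k (ltnSn k); rewrite subSnn size_rcons addn1.
move=> /(ler_wpM2r (f_ge0 (rcons u false))).
rewrite [J (rcons _ _)]path_sum_rcons -/J.
have := ler_wpM2l M0 Eu.
move=> h1 h2 h3; lra.
Qed.


Variables (kappa : nat -> nat) (C c : R).
Hypotheses (C_ge0 : 0 <= C) (blocks : affordable_blocks R kappa s p C c).

(** [d / (1 - d)] comes from the averaging, [C] from the zero block, and 2 from the two energy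
    terms, each at most [delta]. *)
Let K := d / (1 - d) + C + 2.

Let K_gt0 : 0 < K.
Proof.
by rewrite ltr_wpDl// addr_ge0// divr_ge0// ?subr_ge0 ltW.
Qed.

Let N v := 2 `^ ((size v)%:R * s) * E v.

(* Averaging over all words of length [n] below [v]: the energy beyond level [n]
   tends to 0 with [v] fixed, so for a suitable large [n] some block extension has
   arbitrarily small normalised energy, while [J] grows only by [O(delta)]. *)
Lemma exists_block_extension v delta eta m : 0 < delta -> 0 < eta ->
  N v <= delta `^ p ->
  exists n, exists u : seq bool, [/\ (m <= n)%N, size u = n,
    prefix v (u ++ nseq (kappa n) false),
    J (u ++ nseq (kappa n) false) <= J v + K * delta &
    N (u ++ nseq (kappa n) false) <= eta].
Proof.
move=> delta0 eta0 Nv.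
(* [lambda] is a price on the final normalised energy: [lambda * N v' <= K * delta] is the same as
   [N v' <= eta]. In [rho] it is joined to the coefficient of the energy in [path_sum_run]. *)
pose lambda := K * delta / eta.
have lambda0 : 0 < lambda by rewrite divr_gt0// mulr_gt0.
pose rho := delta `^ (1 - p) + lambda.
have rho0 : 0 < rho by rewrite ltr_wpDl// powR_ge0.
(* The factor [c * 2 ^+ size v] is what remains of [M <= c * 2 ^+ n] after division by [2 ^+ k],
   where [n = size v + k]. *)
have [k0 k0P] : exists k0, forall k, (k0 <= k)%N ->
    rho * c * 2 ^+ size v * level_sum E k v <= delta.
  have cv : rho * c * 2 ^+ size v * level_sum E k v @[k --> \oo] --> 0.
    rewrite -[X in _ --> X](mulr0 (rho * c * 2 ^+ size v)).
    by apply: cvgM; [exact: cvg_cst | exact: level_sum_energy_cvg0 f_ge0 cost_le v].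
  have [k0 _ k0P] : \forall k \near \oo,
      rho * c * 2 ^+ size v * level_sum E k v <= delta := cvgr_le _ cv _ delta0.
  by exists k0 => k kk; exact: k0P.
have [n [M [mn M1 M2 tP]]] := blocks (maxn m (size v + k0)).
have [mn' vn] : (m <= n)%N /\ (size v + k0 <= n)%N by apply/andP; rewrite -geq_max.
pose k := (n - size v)%N.
have nE : n = (size v + k)%N by rewrite /k subnKC// (leq_trans _ vn)// leq_addr.
have k0k : (k0 <= k)%N by rewrite -(leq_add2l (size v)) -nE.
have M0 : 0 < M by apply: lt_le_trans M1; rewrite powR_gt0.
(* Potential and priced energy are averaged together, so that one [u] is good for both. *)
pose F u := J u + rho * M * E u.
have [u [vu su]] := exists_le_level_sum F k v.
rewrite -nE in su.
rewrite level_sumD level_sumZ => Fu.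
have {}Fu : F u <= J v + (d / (1 - d) + 2) * delta.
  rewrite -(@ler_pM2l _ (2 ^+ k)) ?exprn_gt0//; apply: (le_trans Fu).
  have h1 := level_sum_path_sum k v _ delta0.
  have h2 : delta `^ (1 - p) * 2 `^ ((size v)%:R * s) * (E v - f v) <= delta.
    apply: (@le_trans _ _ (delta `^ (1 - p) * N v)).
      by rewrite -mulrA ler_wpM2l ?powR_ge0// ler_wpM2l ?powR_ge0// gerBl.
    apply: le_trans (ler_wpM2l (powR_ge0 _ _) Nv) _.
    rewrite -powRD; last by rewrite (gt_eqF delta0) implybT.
    by rewrite subrK powRr1// ltW.
  have h3 : rho * M * level_sum E k v <= 2 ^+ k * delta.
    have S0 : 0 <= level_sum E k v by apply: level_sum_ge0.
    apply: (@le_trans _ _ (rho * (c * 2 ^+ n) * level_sum E k v)).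
      by rewrite ler_wpM2r// ler_wpM2l// ltW.
    rewrite nE exprD.
    rewrite (_ : _ * _ = 2 ^+ k * (rho * c * 2 ^+ size v * level_sum E k v)).
      by rewrite ler_pM2l ?exprn_gt0// k0P.
    by ring.
  apply: le_trans (lerD h1 h3) _.
  by rewrite -mulrDr ler_pM2l ?exprn_gt0//; move: h2; rewrite -/J -/E; lra.
have [t [t0 tsum tM]] := tP _ delta0.
have rM0 : 0 <= delta `^ (1 - p) * M by rewrite mulr_ge0 ?powR_ge0 ?ltW.
have run := path_sum_run (kappa n) u t _ rM0 (fun i _ => t0 i).
rewrite su in run; have {}run := run tM.
set v' := u ++ _ in run *.
have Nv' : N v' <= M * E u.
  rewrite /N /v' size_cat size_nseq su; apply: ler_pM; rewrite ?powR_ge0//.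
  elim: (kappa n) => [|j IHj]; first by rewrite cats0.
  apply: le_trans IHj; rewrite -addn1 nseqD catA cats1.
  rewrite [leRHS]EE; have := f_ge0 (u ++ nseq j false).
  by have := E_ge0 (rcons (u ++ nseq j false) true); lra.
have vv' : prefix v v' by apply: prefix_trans vu _; exact: prefix_prefix.
have key : J v' + lambda * N v' <= J v + K * delta.
  have h1 := ler_wpM2l (ltW lambda0) Nv'.
  have h2 : delta `^ (1 - p) * M * (E u - f u) <= delta `^ (1 - p) * M * E u.
    by rewrite ler_wpM2l// gerBl.
  move: Fu run; rewrite /F /rho /K -/J -/E; lra.
exists n, u; split => //.
  apply: le_trans key; rewrite lerDl; apply: mulr_ge0 (ltW lambda0) _.
  by apply: mulr_ge0 (E_ge0 _); exact: powR_ge0.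
rewrite -(@ler_pM2l _ lambda)//.
have := le_path_sum phi v v' phi_ge0 vv'.
have -> : lambda * eta = K * delta by rewrite /lambda divfK// gt_eqF.
by rewrite -/J; lra.
Qed.

(** Extensions with [delta / 2^i] are iterated from the root: the root contributes at most [delta],
    the increments at most [2 * K * delta]. The blocks start ever later, so the limit word is in
    [D]. *)
Lemma exists_dobinski_path_sum delta : 0 < delta -> B <= delta `^ p ->
  exists2 w, dobinski kappa w &
    forall n, J (mkseq w n) <= (2 * K + 1) * delta.
Proof.
move=> delta0 Bdelta.
pose del i := delta / 2 ^+ i.
have del0 i : 0 < del i by rewrite divr_gt0 ?exprn_gt0.
(* The energy bound is a premise inside the existential, so that [choice] gives a total function;
   [[::]] is a dummy value. *)
have ext (vi : seq bool * nat) : exists v', N vi.1 <= del vi.2 `^ p ->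
    prefix vi.1 v' /\ J v' <= J vi.1 + K * del vi.2 /\
    N v' <= del vi.2.+1 `^ p /\
    exists n, exists u : seq bool,
      [/\ (vi.2.+1 <= n)%N, size u = n & v' = u ++ nseq (kappa n) false].
  have [Nv|] := pselect (N vi.1 <= del vi.2 `^ p); last by exists [::].
  have eta0 : 0 < del vi.2.+1 `^ p by rewrite powR_gt0.
  have [n [u [? ? ? ? ?]]] := exists_block_extension _ _ _ vi.2.+1 (del0 _) eta0 Nv.
  by exists (u ++ nseq (kappa n) false) => _; do 3 split => //; exists n, u.
have [g gP] := choice ext.
pose vs := fix vs i := if i is i'.+1 then g (vs i', i') else [::].
have NB : N (vs 0%N) <= del 0%N `^ p.
  rewrite /N /= mul0r powRr0 mul1r /del expr0 divr1; apply: le_trans Bdelta.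
  exact: energy_le f_ge0 cost_le _.
have Nvs i : N (vs i) <= del i `^ p.
  by elim: i => [//|i IH]; have [_ [_ []]] := gP (vs i, i) IH.
have vsP i := gP (vs i, i) (Nvs i); rewrite /= in vsP.
have J0 : J (vs 0%N) <= delta.
  rewrite /J path_sum_nil leNgt; apply/negP => h.
  have : delta `^ p < phi [::] `^ p.
    by rewrite gt0_ltr_powR ?nnegrE ?(ltW delta0)// (lt_trans _ p_gt1).
  apply/negP; rewrite -leNgt.
  have -> : phi [::] `^ p = f [::] by rewrite phi_powR mul0r powRr0 mul1r.
  apply: le_trans (le_fE [::]) (le_trans (energy_le f B f_ge0 cost_le _) Bdelta).
have Jvs i : J (vs i) <= delta + 2 * K * (delta - del i).
  elim: i => [|i IH]; first by rewrite /del expr0 divr1 subrr mulr0 addr0.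
  have [_ [h _]] := vsP i; apply: (le_trans h).
  have -> : del i.+1 = del i / 2 by rewrite /del exprS invfM; lra.
  lra.
have mono i j : (i <= j)%N -> prefix (vs i) (vs j).
  move=> /subnKC <-; elim: (j - i)%N => [|l IH]; first by rewrite addn0 prefix_refl.
  by rewrite addnS; apply: prefix_trans IH _; have [] := vsP (i + l)%N.
have szvs i : (i <= size (vs i))%N.
  case: i => [//|i]; have [_ [_ [_ [n [u [ni su vE]]]]]] := vsP i.
  by rewrite [vs _]vE size_cat su (leq_trans ni)// leq_addr.
have nth_prefix (x y : seq bool) i : prefix x y -> (i < size x)%N ->
    nth false y i = nth false x i.
  by move=> /prefixP[z ->] ix; rewrite nth_cat ix.
(* [vs i.+1] has at least [i + 1] letters, so the default [false] is never read. *)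
pose w i := nth false (vs i.+1) i.
have wE l i : (i < size (vs l))%N -> w i = nth false (vs l) i.
  move=> il; rewrite /w; have [h|h] := leqP i.+1 l.
    by rewrite (nth_prefix _ _ _ (mono _ _ h)).
  by rewrite -(nth_prefix _ _ _ (mono _ _ (ltnW h))).
exists w.
  move=> m /= m1; have [_ [_ [_ [n [u [mn su vE]]]]]] := vsP m.
  exists n => /=; first exact: ltnW.
  move=> i ik; rewrite (wE m.+1) [vs _]vE.
    by rewrite nth_cat su ltnNge leq_addr /= addKn nth_nseq ik.
  by rewrite size_cat su size_nseq ltn_add2l.
move=> n; apply: (@le_trans _ _ (J (vs n))).
  apply: le_path_sum => //.
  rewrite prefixE size_mkseq; apply/eqP/(@eq_from_nth _ false).
    by rewrite size_mkseq size_takel.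
  move=> i; rewrite size_takel// => i_n.
  by rewrite nth_take// nth_mkseq// (wE n)// (leq_trans i_n).
apply: (le_trans (Jvs n)).
have := mulr_gt0 K_gt0 (del0 n); lra.
Qed.

End LowerBound.

(** An admissible [phi] of cost at most [delta^p], with [delta = 1 / (2K + 2)], would have potential
    at most [(2K + 1) delta < 1] at some word of [D]. *)
Lemma capacity_dobinski_gt0 (R : realType) (a p C c : R) (kappa : nat -> nat) :
  0 < a -> 1 < p -> 0 <= C -> affordable_blocks R kappa (1 - a * p) p C c ->
  (0 < capacity a p (dobinski kappa))%E.
Proof.
move=> a0 p1 C0 blocks.
pose d : R := 2 `^ (- a).
pose K := d / (1 - d) + C + 2.
have K0 : 0 <= K.
  rewrite !addr_ge0// divr_ge0 ?powR_ge0// subr_ge0 /d powRN invf_le1 ?powR_gt0//.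
  by rewrite -[leLHS](@powRr0 _ 2) ler_powR ?ler1n// ltW.
pose delta := (2 * K + 2)^-1.
have delta0 : 0 < delta by rewrite invr_gt0; lra.
have deltaK : (2 * K + 1) * delta < 1.
  by rewrite ltr_pdivrMr; lra.
apply: (@lt_le_trans _ _ (delta `^ p)%:E); first by rewrite lte_fin powR_gt0.
apply: le_ereal_inf_tmp => _ [phi [phi0 adm] <-].
rewrite leNgt; apply/negP => /ltW cost.
have [w wD wJ] := exists_dobinski_path_sum a p phi (delta `^ p) a0 p1 phi0 cost
  kappa C c C0 blocks delta delta0 (lexx _).
have := adm w wD; rewrite potentialE//; apply/negP; rewrite -ltNge.
apply: (@le_lt_trans _ _ ((2 * K + 1) * delta)%:E); last by rewrite lte_fin.
apply: lime_le; first by apply: is_cvg_nneseries => n _ _; rewrite lee_fin.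
apply: nearW => n; apply: (@le_trans _ _ (path_sum phi (mkseq w n))%:E).
  by rewrite path_sum_mkseq sumEFin lee_fin big_nat_recr//= lerDl.
by rewrite lee_fin.
Qed.

(** * Upper bounds *)

(** With [j] counted from 0, [x] ends at the [(j+1)]-st zero of a block that follows [n] free
    letters. *)
Definition on_block (n j : nat) (x : seq bool) : bool :=
  (size x == n + j.+1)%N && (drop n x == nseq j.+1 false).

(** Such a word is determined by its first [n] letters. *)
Lemma count_on_block_le (n j : nat) (X : seq (seq bool)) : uniq X ->
  (count (on_block n j) X <= 2 ^ n)%N.
Proof.
move=> uX; rewrite -size_filter.
have -> : (2 ^ n)%N = size [seq val t ++ nseq j.+1 false | t : n.-tuple bool].
  by rewrite size_map -cardT card_tuple card_bool.
apply: uniq_leq_size; first exact: filter_uniq.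
move=> x; rewrite mem_filter => /andP[/andP[/eqP sx /eqP dx] _].
have st : size (take n x) == n by rewrite size_takel// sx leq_addr.
by apply/mapP; exists (Tuple st); rewrite ?mem_enum// -dx /= cat_take_drop.
Qed.

Lemma on_block_mkseq (n j k : nat) (w : boundary) : (j < k)%N ->
  zero_block n k w -> on_block n j (mkseq w (n + j.+1)).
Proof.
move=> jk wn; rewrite /on_block size_mkseq eqxx andTb; apply/eqP.
apply: (@eq_from_nth _ false).
  by rewrite size_drop size_mkseq addKn size_nseq.
rewrite size_drop size_mkseq addKn => i ij.
by rewrite nth_drop nth_mkseq ?ltn_add2l// nth_nseq ij wn// (leq_trans ij).
Qed.

Lemma le_summand_nat (R : realType) (F : nat -> R) (m n k : nat) :
  (forall i, 0 <= F i) -> (m <= k < n)%N -> F k <= \sum_(m <= i < n) F i.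
Proof.
move=> F0 kmn; rewrite (big_rem k) ?mem_index_iota//= lerDl.
by rewrite sumr_ge0.
Qed.

Section UpperBound.
Context {R : realType}.
Variables (a p : R) (kappa : nat -> nat) (r : nat -> nat -> R).
Hypotheses (p_gt1 : 1 < p) (r_ge0 : forall n j, 0 <= r n j).

Let weight (l : nat) : R := 2 `^ (- (l%:R * (1 - a * p))).

(** [r n j] is the charge of each of the [2^n] vertices satisfying [on_block n j]. *)
Let block_cost n : R :=
  2 ^+ n * \sum_(j < kappa n) r n j `^ p * weight (n + j.+1).

(* The [l^p] combination over [n] makes the cost additive in [n], while each single
   block function remains a lower bound. *)
Let powsum (m : nat) (x : seq bool) : R := \sum_(m <= n < size x)
  \sum_(j < kappa n) if on_block n j x then r n j `^ p else 0.

Let test (m : nat) (x : seq bool) : R := powsum m x `^ p^-1.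

Let summand_ge0 n x :
  0 <= \sum_(j < kappa n) if on_block n j x then r n j `^ p else 0.
Proof. by apply: sumr_ge0 => j _; case: ifP => // _; exact: powR_ge0. Qed.

Let powsum_ge0 m x : 0 <= powsum m x.
Proof. by apply: sumr_ge0. Qed.

Let p_neq0 : p != 0. Proof. by rewrite gt_eqF// (lt_trans _ p_gt1). Qed.

Let test_ge m n j x : (m <= n)%N -> (j < kappa n)%N -> on_block n j x ->
  r n j <= test m x.
Proof.
move=> mn jk nx; rewrite -[leLHS](@powRr1 _ (r n j))// -(divff p_neq0) powRrM.
have p0 : 0 <= p^-1 by rewrite invr_ge0 ltW// (lt_trans _ p_gt1).
rewrite ge0_ler_powR// ?nnegrE ?powR_ge0//.
(* [powsum] stops before [size x]; a vertex of block [n] is longer than [n], so its term is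
   present. *)
have sx : (n < size x)%N.
  by case/andP: nx => /eqP-> _; rewrite addnS ltnS leq_addr.
apply: le_trans (le_summand_nat _ _ _ _ n _ _) => //; last by rewrite mn.
rewrite (bigD1 (Ordinal jk))//= nx lerDl sumr_ge0// => i _.
by case: ifP => // _; exact: powR_ge0.
Qed.

(** The power [p] cancels the root in [test]; then the sums are exchanged and the vertices counted.
    [L] gives all words a common range of [n]. *)
Let cost_le m (X : seq (seq bool)) L : uniq X ->
  (forall x, x \in X -> (size x <= L)%N) ->
  \sum_(x <- X) test m x `^ p * weight (size x) <=
  \sum_(m <= n < L) block_cost n.
Proof.
move=> uX XL.
pose T n x := \sum_(j < kappa n)
  if on_block n j x then r n j `^ p * weight (n + j.+1) else 0.
have T0 n x : 0 <= T n x.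
  by apply: sumr_ge0 => j _; case: ifP => // _; rewrite mulr_ge0 ?powR_ge0.
apply: (@le_trans _ _ (\sum_(x <- X) \sum_(m <= n < L) T n x)).
  rewrite big_seq [leRHS]big_seq; apply: ler_sum => x /XL xL.
  rewrite /test -powRrM mulVf// powRr1// /powsum mulr_suml.
  rewrite (big_nat_widen _ _ _ _ _ xL) big_mkcond /=; apply: ler_sum => n _.
  case: ifP => [nx|_] //; rewrite mulr_suml; apply: ler_sum => j _.
  by case: ifP => [/andP[/eqP-> _]|_]; rewrite ?mul0r.
rewrite exchange_big /=; apply: ler_sum => n _.
rewrite exchange_big /= /block_cost mulr_sumr; apply: ler_sum => j _.
rewrite -big_mkcond /= big_const_seq iter_addr_0 -[leLHS]mulr_natl.
rewrite ler_wpM2r ?mulr_ge0 ?powR_ge0// -natrX ler_nat.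
exact: count_on_block_le.
Qed.

(** A word of [D] has a zero block at some [n >= m], whose charges alone give potential 1, while
    [test m] costs at most the tail of the series from [m]. *)
Lemma capacity_dobinski_eq0 :
  (forall n, 1 <= \sum_(j < kappa n) r n j) ->
  (\sum_(0 <= n <oo) (block_cost n)%:E < +oo)%E ->
  capacity a p (dobinski kappa) = 0%E.
Proof.
move=> r1 fin.
have cost0 n : (0 <= (block_cost n)%:E)%E.
  rewrite lee_fin mulr_ge0 ?exprn_ge0// sumr_ge0// => j _.
  by rewrite mulr_ge0 ?powR_ge0.
apply/eqP; rewrite eq_le; apply/andP; split; last first.
  apply: le_ereal_inf_tmp => _ [phi _ <-]; apply: esum_ge0 => x _.
  by rewrite lee_fin mulr_ge0 ?powR_ge0.
apply/lee_addgt0Pr => e e0; rewrite add0e.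
have [m m1 me] : exists2 m, (1 <= m)%N &
    (\sum_(m <= n <oo) (block_cost n)%:E <= e%:E)%E.
  have cv := nneseries_tail_cvg fin (fun n _ => cost0 n).
  have e0' : (0 < e%:E)%E by rewrite lte_fin.
  have [N _ NP] := cv _ (open_ereal_lt' e0').
  by exists N.+1 => //; apply: ltW; apply: NP => /=.
apply: ge_ereal_inf; exists (\esum_(x in [set: seq bool])
    (test m x `^ p * 2 `^ (- ((size x)%:R * (1 - a * p))))%:E)%E.
  exists (test m) => //=; split=> [x|w wD]; first exact: powR_ge0.
  have [n /= mn wn] := wD m m1.
  rewrite potentialE; last by move=> x; exact: powR_ge0.
  apply: (@le_trans _ _ (\sum_(0 <= i < n.+1 + kappa n) (test m (mkseq w i))%:E)%E).
    rewrite sumEFin lee_fin (@big_cat_nat _ _ _ n.+1)//= ?leq_addr//.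
    rewrite ler_wpDl//; first by apply: sumr_ge0 => i _; exact: powR_ge0.
    rewrite -[X in \sum_(X <= _ < _) _]add0n big_addn addKn big_mkord.
    apply: (le_trans (r1 n)); apply: ler_sum => j _.
    apply: (test_ge _ _ _ _ mn (ltn_ord j)).
    by rewrite addnC addSnnS; exact: on_block_mkseq (ltn_ord j) wn.
  by apply: nneseries_lim_ge => i _ _; rewrite lee_fin powR_ge0.
apply: le_trans me; apply: ge_ereal_sup => _ [X [finX _] <-].
rewrite fsbig_finite//= sumEFin.
pose L := (\max_(x <- finmap.enum_fset (fset_set X)) size x)%N.
apply: (@le_trans _ _ (\sum_(m <= n < L) (block_cost n)%:E)%E).
  rewrite sumEFin lee_fin; apply: cost_le; first exact: finmap.fset_uniq.
  by move=> x xX; rewrite /L (big_rem x)//= leq_maxl.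
by apply: nneseries_lim_ge => i _ _; exact: cost0.
Qed.

End UpperBound.

(** * Critical and subcritical blocks *)

Lemma limn_esup_gt (R : realType) (u : nat -> \bar R) (x : \bar R) (m : nat) :
  (x < limn_esup u)%E -> exists2 n, (m <= n)%N & (x < u n)%E.
Proof.
move=> xu; apply: contrapT => h; move: xu; apply/negP; rewrite -leNgt.
apply: ge_ereal_inf; exists (ereal_sup (u @` [set n | (m <= n)%N])).
  by exists [set n | (m <= n)%N] => //; exists m.
apply: ge_ereal_sup => _ [n /= mn <-]; rewrite leNgt; apply/negP => xn.
by apply: h; exists n.
Qed.

(** Constant thresholds [delta / kappa n] give [M = (kappa n)^(p-1)]; [c] is the inverse of a
    positive real below the limsup. *)
Lemma affordable_blocks_critical (R : realType) (kappa : nat -> nat) (p : R) :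
  (forall n, (0 < kappa n)%N) -> 1 < p ->
  (0 < limn_esup (fun n => ((kappa n)%:R `^ (- (p - 1)) * 2 ^+ n)%:E))%E ->
  exists c, affordable_blocks R kappa 0 p 1 c.
Proof.
move=> kappa0 p1 lim0.
have [x x0 xlim] : exists2 x : R, 0 < x &
    (x%:E < limn_esup (fun n => ((kappa n)%:R `^ (- (p - 1)) * 2 ^+ n)%:E))%E.
  case: limn_esup lim0 => [l|_|//]; last by exists 1; rewrite ?ltry.
  rewrite lte_fin => l0; exists (l / 2); rewrite ?divr_gt0// lte_fin.
  by rewrite gtr_pMr// invf_lt1// ltr1n.
exists x^-1 => m; have [n mn] := limn_esup_gt _ _ _ m xlim.
rewrite lte_fin powRN => xn; exists n, ((kappa n)%:R `^ (p - 1)).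
have k0 : 0 < (kappa n)%:R :> R by rewrite ltr0n.
split => //.
- rewrite mulr0 powRr0 -[leLHS](@powRr0 _ (kappa n)%:R) ler_powR ?ler1n//.
  by rewrite subr_ge0 ltW.
- by rewrite ler_pdivlMl// mulrC -ler_pdivlMl ?powR_gt0// ltW.
move=> delta delta0; exists (fun=> delta / (kappa n)%:R); split.
- by move=> _; rewrite divr_gt0.
- by rewrite sumr_const card_ord -[leLHS]mulr_natr divfK ?mul1r// gt_eqF.
move=> i _; rewrite mulr0 powRr0 mulr1 powRM ?invr_ge0 ?(ltW delta0) ?(ltW k0)//.
by rewrite -powR_inv1 ?(ltW k0)// -powRrM mulN1r opprB.
Qed.

(** The thresholds [delta * q ^+ i] are summable, and [q^(1-p) = 2^s] makes every coefficient equal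
    to [delta^(1-p) M] with [M = 2^((n + kappa n) s)]. A real [x] below the limsup gives
    [c = 2^(-x)]. *)
Lemma affordable_blocks_subcritical (R : realType) (kappa : nat -> nat) (s p : R) :
  0 < s -> 1 < p ->
  (-oo < limn_esup (fun n => ((1 - s) * n%:R - s * (kappa n)%:R)%:E))%E ->
  exists2 C, 0 <= C & exists c, affordable_blocks R kappa s p C c.
Proof.
move=> s0 p1 limNy.
have [x xlim] : exists x : R,
    (x%:E < limn_esup (fun n => ((1 - s) * n%:R - s * (kappa n)%:R)%:E))%E.
  case: limn_esup limNy => [l _|_|//]; last by exists 1; rewrite ltry.
  by exists (l - 1); rewrite lte_fin gtrBl.
have p10 : 0 < p - 1 by rewrite subr_gt0.
pose q : R := 2 `^ (- (s / (p - 1))).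
have q0 : 0 < q by rewrite powR_gt0.
have q1 : q < 1.
  rewrite /q powRN invf_lt1 ?powR_gt0// /powR pnatr_eq0 expR_gt1.
  by rewrite mulr_gt0 ?divr_gt0// ln_gt0// ltr1n.
exists (1 - q)^-1; first by rewrite invr_ge0 subr_ge0 ltW.
exists (2 `^ (- x)) => m; have [n mn] := limn_esup_gt _ _ _ m xlim.
rewrite lte_fin => xn; exists n, (2 `^ ((n + kappa n)%:R * s)); split => //.
  rewrite -powR_mulrn// -powRD ?pnatr_eq0 ?implybT// ler_powR ?ler1n//.
  by rewrite natrD; move: xn; lra.
move=> delta delta0; exists (fun i => delta * q ^+ i); split.
- by move=> i; rewrite mulr_gt0 ?exprn_gt0.
- rewrite -mulr_sumr mulrC ler_pM2r// -[leRHS]mul1r ler_pdivlMr ?subr_gt0//.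
  have := subrX1 q (kappa n).
  have := exprn_gt0 (kappa n) q0.
  by lra.
move=> i ik; rewrite powRM ?exprn_ge0 ?(ltW delta0) ?(ltW q0)//.
rewrite -mulrA ler_wpM2l ?powR_ge0//.
rewrite -powR_mulrn ?(ltW q0)// -!powRrM -powRD ?pnatr_eq0 ?implybT//.
rewrite ler_powR ?ler1n// natrD natrB ?(ltnW ik)//.
rewrite [X in X <= _](_ : _ = (n + kappa n)%:R * s) ?natrD//.
by field; rewrite gt_eqF.
Qed.

Theorem theorem3p2 (R : realType) (kappa : nat -> nat)
    (kappa_gt0 : forall n, (0 < kappa n)%N) (a p : R)
    (a_gt0 : 0 < a) (p_gt1 : 1 < p) :
  (a * p = 1 ->
    ((0 < limn_esup
            (fun n => ((kappa n)%:R `^ (- (p - 1)) * 2 ^+ n)%:E))%E ->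
      (0 < capacity (1 / p) p (dobinski kappa))%E) /\
    ((\sum_(1 <= n <oo)
        ((kappa n)%:R `^ (- (p - 1)) * 2 ^+ n)%:E < +oo)%E ->
      capacity (1 / p) p (dobinski kappa) = 0%E)) /\
  (a * p < 1 ->
    ((-oo < limn_esup
              (fun n => (a * p * n%:R - (1 - a * p) * (kappa n)%:R)%:E))%E ->
      (0 < capacity a p (dobinski kappa))%E) /\
    ((\sum_(0 <= n <oo)
        (2 `^ (a * p * n%:R - (1 - a * p) * (kappa n)%:R))%:E < +oo)%E ->
      capacity a p (dobinski kappa) = 0%E)).
Proof.
have p0 : 0 < p := lt_trans ltr01 p_gt1.
split=> [ap1|ap1].
  have -> : 1 / p = a by rewrite -ap1 mulfK// gt_eqF.
  split=> [lim0|fin].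
    have [c blocks] := affordable_blocks_critical _ _ _ kappa_gt0 p_gt1 lim0.
    by apply: (capacity_dobinski_gt0 _ _ _ 1 c); rewrite // ap1 subrr.
  have kappa0 n : 0 < (kappa n)%:R :> R by rewrite ltr0n.
  apply: (capacity_dobinski_eq0 _ _ _ (fun n _ => (kappa n)%:R^-1)) => //.
    by move=> n; rewrite sumr_const card_ord -[leRHS]mulr_natr mulVf// gt_eqF.
  under eq_eseriesr => n _.
    rewrite (_ : 2 ^+ n * _ = (kappa n)%:R `^ (- (p - 1)) * 2 ^+ n); last first.
      under eq_bigr do rewrite ap1 subrr mulr0 oppr0 powRr0 mulr1.
      rewrite mulrC; congr (_ * _); rewrite sumr_const card_ord -[LHS]mulr_natl.
      rewrite -powR_inv1 ?(ltW (kappa0 n))// -powRrM mulN1r.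
      rewrite -[X in X * _]powRr1 ?(ltW (kappa0 n))//.
      rewrite -powRD ?(gt_eqF (kappa0 n)) ?implybT//.
      by congr (_ `^ _); ring.
    over.
  (* The given series starts at 1; the extra term at 0 is finite. *)
  rewrite (@nneseries_split _ _ 0 1); last first.
    by move=> n _; rewrite lee_fin mulr_ge0 ?powR_ge0 ?exprn_ge0.
  by rewrite add0n big_nat1 lte_add_pinfty// ltry.
have s0 : 0 < 1 - a * p by rewrite subr_gt0.
split=> [limNy|fin].
  have := affordable_blocks_subcritical _ kappa _ _ s0 p_gt1.
  rewrite subKr => /(_ limNy)[C C0 [c blocks]].
  exact: (capacity_dobinski_gt0 _ _ _ C c).
(* Only the last vertex of each block is charged. *)
pose r n j : R := if j.+1 == kappa n then 1 else 0.
apply: (capacity_dobinski_eq0 _ _ _ r) => //.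
- by move=> n j; rewrite /r; case: ifP.
- move=> n; rewrite /r; case: (kappa n) (kappa_gt0 n) => // k _.
  by rewrite big_ord_recr /= eqxx lerDr sumr_ge0// => j _; case: ifP.
move: fin; congr (_ < _)%E; apply: eq_eseriesr => n _; congr EFin.
rewrite /r; case: (kappa n) (kappa_gt0 n) => // k _.
rewrite big_ord_recr /= big1 ?add0r => [|j _]; last first.
  by rewrite eqSS ltn_eqF// powR0 ?mul0r// gt_eqF.
rewrite eqxx powR1 mul1r -powR_mulrn// -powRD ?pnatr_eq0 ?implybT//.
by congr (_ `^ _); rewrite natrD; ring.
Qed.
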